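(* For every integer $d \ge 0$ there is a polynomial $P_d$, whose degree is linear in $d$, such that for every term $t$ of depth $d(t)=d$, every sequence of one-step reductions $t = t_0 \to t_1 \to \cdots \to t_m$ starting from $t$ has length $m \le P_d(|t|)$.
   Context: Pseudo-terms are given by the grammar $t ::= x \mid \lambda x.t \mid (t\,t') \mid\, !t \mid \mathrm{let}\ t\ \mathrm{be}\ !x\ \mathrm{in}\ t'$. In $\mathrm{let}\ u\ \mathrm{be}\ !x\ \mathrm{in}\ t_1$ the variable $x$ is bound in $t_1$: $FV(\mathrm{let}\ u\ \mathrm{be}\ !x\ \mathrm{in}\ t_1)=FV(u)\cup(FV(t_1)\setminus\{x\})$; $\lambda$ binds as usual. $FV(t)$ is the set of free variables of $t$, and $no(x,t)$ is the number of free occurrences of $x$ in $t$. Terms and their sets of temporary variables $TV(t)\subseteq FV(t)$ are defined simultaneously as the smallest set of pseudo-terms such that: (i) a variable $x$ is a term, $TV(x)=\emptyset$; (ii) $\lambda x.t$ is a term iff $t$ is a term, $x\notin TV(t)$ and $no(x,t)\le 1$, and then $TV(\lambda x.t)=TV(t)$; (iii) $(t_1\,t_2)$ is a term iff $t_1,t_2$ are terms, $TV(t_1)\cap FV(t_2)=\emptyset$ and $FV(t_1)\cap TV(t_2)=\emptyset$, and then $TV(t_1\,t_2)=TV(t_1)\cup TV(t_2)$; (iv) $!t$ is a term iff $t$ is a term, $TV(t)=\emptyset$ and $no(x,t)=1$ for all $x\in FV(t)$, and then $TV(!t)=FV(t)$; (v) $\mathrm{let}\ t_1\ \mathrm{be}\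 !x\ \mathrm{in}\ t_2$ is a term iff $t_1,t_2$ are terms, $TV(t_1)\cap FV(t_2)=\emptyset$ and $FV(t_1)\cap TV(t_2)=\emptyset$, and then its $TV$ is $TV(t_1)\cup(TV(t_2)\setminus\{x\})$. Size: $|x|=1$, $|\lambda x.t|=|t|+1$, $|(t\,t')|=|t|+|t'|$, $|!t|=|t|+1$, $|\mathrm{let}\ t\ \mathrm{be}\ !x\ \mathrm{in}\ t'|=|t|+|t'|+1$. Depth: for an occurrence $u$ of a subterm of $t$, its depth in $t$ is the number of subterm occurrences $v$ of $t$ of the form $!v'$ such that $u$ is a subterm of $v$; the depth $d(t)$ of $t$ is the maximum depth of its subterm occurrences. One-step reduction $\to$ is the contextual closure of the rules: $(\beta)$ $((\lambda x.t)\,u)\to t[u/x]$; (bang) $\mathrm{let}\ !u\ \mathrm{be}\ !x\ \mathrm{in}\ t\to t[u/x]$; (com1) $\mathrm{let}\ (\mathrm{let}\ t_1\ \mathrm{be}\ !y\ \mathrm{in}\ t_2)\ \mathrm{be}\ !x\ \mathrm{in}\ t_3 \to \mathrm{let}\ t_1\ \mathrm{be}\ !y\ \mathrm{in}\ (\mathrm{let}\ t_2\ \mathrm{be}\ !x\ \mathrm{in}\ t_3)$; (com2) $((\mathrm{let}\ t_1\ \mathrm{be}\ !x\ \mathrm{in}\ t_2)\ t_3)\to \mathrm{let}\ t_1\ \mathrm{be}\ !x\ \mathrm{in}\ (t_2\,t_3)$. Here $t[u/x]$ denotes capture-avoiding substitution. *)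

(* Defs.v *)
From HB Require Import structures.
From mathcomp Require Import all_boot all_order all_algebra.

Set Implicit Arguments.
Unset Strict Implicit.
Unset Printing Implicit Defensive.

(* Pseudo-terms up to alpha-equivalence, in de Bruijn form. [Lam t] binds     *)
(* index 0 of [t]; [Let u t] is "let u be !x in t", and binds index 0 of [t]  *)
(* only.                                                                      *)
Inductive pterm : Type :=
  | Var of nat
  | Lam of pterm
  | App of pterm & pterm
  | Bang of pterm
  | Let of pterm & pterm.

(* [under A] is A \ {x} for the variable x of a binder, seen from outside it: *)
(* index 0 is dropped and the other indices are decremented.                  *)
Definition under (A : pred nat) : pred nat := [pred y | A y.+1].

Fixpoint FV (t : pterm) : pred nat :=
  match t with
  | Var y => pred1 y
  | Lam t1 => under (FV t1)
  | App t1 t2 => predU (FV t1) (FV t2)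
  | Bang t1 => FV t1
  | Let t1 t2 => predU (FV t1) (under (FV t2))
  end.

Fixpoint no (x : nat) (t : pterm) : nat :=
  match t with
  | Var y => x == y
  | Lam t1 => no x.+1 t1
  | App t1 t2 => no x t1 + no x t2
  | Bang t1 => no x t1
  | Let t1 t2 => no x t1 + no x.+1 t2
  end.

(* Total on pseudo-terms, but meaningful on terms only.                       *)
Fixpoint TV (t : pterm) : pred nat :=
  match t with
  | Var _ => pred0
  | Lam t1 => under (TV t1)
  | App t1 t2 => predU (TV t1) (TV t2)
  | Bang t1 => FV t1
  | Let t1 t2 => predU (TV t1) (under (TV t2))
  end.

Definition disjoint_vars (A B : pred nat) : Prop := forall x, ~~ (A x && B x).

Inductive is_term : pterm -> Prop :=
  | is_term_var x : is_term (Var x)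
  | is_term_lam t :
      is_term t -> ~~ TV t 0 -> no 0 t <= 1 -> is_term (Lam t)
  | is_term_app t1 t2 :
      is_term t1 -> is_term t2 ->
      disjoint_vars (TV t1) (FV t2) -> disjoint_vars (FV t1) (TV t2) ->
      is_term (App t1 t2)
  | is_term_bang t :
      is_term t -> (forall x, ~~ TV t x) -> (forall x, FV t x -> no x t = 1) ->
      is_term (Bang t)
  | is_term_let t1 t2 :
      is_term t1 -> is_term t2 ->
      disjoint_vars (TV t1) (under (FV t2)) ->
      disjoint_vars (FV t1) (under (TV t2)) ->
      is_term (Let t1 t2).

Fixpoint term_size (t : pterm) : nat :=
  match t with
  | Var _ => 1
  | Lam t1 => term_size t1 + 1
  | App t1 t2 => term_size t1 + term_size t2
  | Bang t1 => term_size t1 + 1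
  | Let t1 t2 => term_size t1 + term_size t2 + 1
  end.

(* Subterm occurrences are represented by paths from the root: 0 is the first *)
(* (or only) immediate subterm, 1 the second. The occurrence at p is a        *)
(* subterm of the occurrence at q iff q is a prefix of p.                     *)
Fixpoint occs (t : pterm) : seq (seq nat) :=
  [::] ::
  match t with
  | Var _ => [::]
  | Lam t1 | Bang t1 => [seq 0 :: p | p <- occs t1]
  | App t1 t2 | Let t1 t2 =>
      [seq 0 :: p | p <- occs t1] ++ [seq 1 :: p | p <- occs t2]
  end.

Fixpoint bang_at (t : pterm) (p : seq nat) : bool :=
  match p, t with
  | [::], Bang _ => true
  | 0 :: p', (Lam t1 | Bang t1 | App t1 _ | Let t1 _) => bang_at t1 p'
  | 1 :: p', (App _ t2 | Let _ t2) => bang_at t2 p'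
  | _, _ => false
  end.

Definition occ_depth (t : pterm) (p : seq nat) : nat :=
  count (fun q => bang_at t q && prefix q p) (occs t).

Definition depth (t : pterm) : nat := \max_(p <- occs t) occ_depth t p.

(* [shift c t] increments every free variable of [t] with index at least c.   *)
Fixpoint shift (c : nat) (t : pterm) : pterm :=
  match t with
  | Var y => Var (if y < c then y else y.+1)
  | Lam t1 => Lam (shift c.+1 t1)
  | App t1 t2 => App (shift c t1) (shift c t2)
  | Bang t1 => Bang (shift c t1)
  | Let t1 t2 => Let (shift c t1) (shift c.+1 t2)
  end.

(* [subst k u t] replaces index k by [u] and removes it: indices above k are  *)
(* decremented. Hence t[u/x], for [t] the body of a binder of x, is           *)
(* [subst 0 u t].                                                             *)
Fixpoint subst (k : nat) (u t : pterm) : pterm :=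
  match t with
  | Var y => if y < k then Var y else if y == k then u else Var y.-1
  | Lam t1 => Lam (subst k.+1 (shift 0 u) t1)
  | App t1 t2 => App (subst k u t1) (subst k u t2)
  | Bang t1 => Bang (subst k u t1)
  | Let t1 t2 => Let (subst k u t1) (subst k.+1 (shift 0 u) t2)
  end.

(* In the commutation rules t3 moves under one more binder; in com1 its own   *)
(* bound variable x keeps index 0, so that only the indices from 1 shift.     *)
Inductive step : pterm -> pterm -> Prop :=
  | step_beta t u : step (App (Lam t) u) (subst 0 u t)
  | step_bang u t : step (Let (Bang u) t) (subst 0 u t)
  | step_com1 t1 t2 t3 :
      step (Let (Let t1 t2) t3) (Let t1 (Let t2 (shift 1 t3)))
  | step_com2 t1 t2 t3 :
      step (App (Let t1 t2) t3) (Let t1 (App t2 (shift 0 t3)))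
  | ctx_lam t t' : step t t' -> step (Lam t) (Lam t')
  | ctx_app_l t t' u : step t t' -> step (App t u) (App t' u)
  | ctx_app_r t u u' : step u u' -> step (App t u) (App t u')
  | ctx_bang t t' : step t t' -> step (Bang t) (Bang t')
  | ctx_let_l t t' u : step t t' -> step (Let t u) (Let t' u)
  | ctx_let_r t u u' : step u u' -> step (Let t u) (Let t u').

(* Main.v *)
Require Import Defs.
From HB Require Import structures.
From mathcomp Require Import all_boot all_order all_algebra.
From mathcomp Require Import zify.

(** In a term, a temporary variable has a single occurrence, inside one bang,
    while the occurrences of any other free variable are all outside bangs.
    Hence only boxes are ever copied, and the free variables of a copied box
    end up at depth 0, where no further copying happens: the maximal number [n]
    of occurrences of a let-bound variable never increases.  With the weight
    [W(!t) = n * W(t) + 1], which reserves [n] copies of every box, (beta) and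
    (bang) strictly decrease [W], and [W(t) <= |t| * n ^ d].  The commutations
    preserve [W] and decrease the sum [M <= W ^ 2] of the weights of all left
    operands, so a reduction has length at most [W * (W ^ 2 + 1) + W ^ 2]. *)

(** * Free and temporary variables *)

#[local] Arguments under A x /.

Lemma FVE t x : FV t x = (0 < no x t).
Proof.
elim: t x => [y|t IH|t1 IH1 t2 IH2|t IH|t1 IH1 t2 IH2] x //=.
- by rewrite lt0b eq_sym.
- by rewrite addn_gt0 -IH1 -IH2.
- by rewrite addn_gt0 -IH1 -IH2.
Qed.

Lemma TV_FV t x : TV t x -> FV t x.
Proof.
elim: t x => [y|t IH|t1 IH1 t2 IH2|t IH|t1 IH1 t2 IH2] x //=.
- exact: IH.
- by case/orP => [/IH1|/IH2] ->; rewrite ?orbT.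
- by case/orP => [/IH1|/IH2] ->; rewrite ?orbT.
Qed.

Lemma is_term_lam_inv t :
  is_term (Lam t) -> [/\ is_term t, ~~ TV t 0 & no 0 t <= 1].
Proof. by move=> H; inversion H. Qed.

Lemma is_term_app_inv t1 t2 : is_term (App t1 t2) ->
  [/\ is_term t1, is_term t2, disjoint_vars (TV t1) (FV t2)
    & disjoint_vars (FV t1) (TV t2)].
Proof. by move=> H; inversion H. Qed.

Lemma is_term_bang_inv t : is_term (Bang t) ->
  [/\ is_term t, forall x, ~~ TV t x & forall x, FV t x -> no x t = 1].
Proof. by move=> H; inversion H. Qed.

Lemma is_term_let_inv t1 t2 : is_term (Let t1 t2) ->
  [/\ is_term t1, is_term t2, disjoint_vars (TV t1) (under (FV t2))
    & disjoint_vars (FV t1) (under (TV t2))].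
Proof. by move=> H; inversion H. Qed.

(** The disjointness conditions at [App] and [Let] keep a temporary variable out of the other
    operand, so the single occurrence imposed inside a bang stays the only one. *)
Lemma TV_no t x : is_term t -> TV t x -> no x t = 1.
Proof.
move=> tt; elim: tt x => {t} [//|t _ IH _ _|t1 t2 _ IH1 _ IH2 D1 D2|t _ _ _ H|
  t1 t2 _ IH1 _ IH2 D1 D2] x /=.
- exact: IH.
- have /= := D1 x; have /= := D2 x; rewrite !FVE => d2 d1.
  by case/orP => h; [have := IH1 _ h | have := IH2 _ h]; lia.
- exact: H.
- have /= := D1 x; have /= := D2 x; rewrite !FVE => d2 d1.
  by case/orP => h; [have := IH1 _ h | have := IH2 _ h]; lia.
Qed.

(** * Shifting *)

Lemma ltn_bumpE c y : (if y < c then y else y.+1) = bump c y.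
Proof. by rewrite /bump; case: ltnP. Qed.

(** Index [c] is fresh in a term shifted at [c] and all others come from the unshifted term, so this
    split settles the side conditions on shifted terms. *)
Lemma bump_cases c x : x = c \/ exists y, x = bump c y.
Proof.
have [->|nxc] := eqVneq x c; first by left.
by right; exists (unbump c x); rewrite unbumpK.
Qed.

Lemma no_shift c t x : no (bump c x) (shift c t) = no x t.
Proof.
elim: t c x => [y|t IH|t1 IH1 t2 IH2|t IH|t1 IH1 t2 IH2] c x //=.
- by rewrite ltn_bumpE (inj_eq (can_inj (bumpK c))).
- by rewrite -bumpS IH.
- by rewrite IH1 IH2.
- by rewrite -bumpS IH1 IH2.
Qed.

Lemma no_shift_same c t : no c (shift c t) = 0.
Proof.
elim: t c => [y|t IH|t1 IH1 t2 IH2|t IH|t1 IH1 t2 IH2] c //=.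
- by rewrite ltn_bumpE (negPf (neq_bump c y)).
- by rewrite IH1 IH2.
- by rewrite IH1 IH2.
Qed.

Lemma FV_shift c t x : FV (shift c t) (bump c x) = FV t x.
Proof. by rewrite !FVE no_shift. Qed.

Lemma FV_shift_same c t : FV (shift c t) c = false.
Proof. by rewrite FVE no_shift_same. Qed.

Lemma TV_shift c t x : TV (shift c t) (bump c x) = TV t x.
Proof.
elim: t c x => [y|t IH|t1 IH1 t2 IH2|t IH|t1 IH1 t2 IH2] c x //=.
- by rewrite -bumpS IH.
- by rewrite IH1 IH2.
- exact: FV_shift.
- by rewrite -bumpS IH1 IH2.
Qed.

Lemma TV_shift_same c t : TV (shift c t) c = false.
Proof. by apply/negP => /TV_FV; rewrite FV_shift_same. Qed.

Lemma is_term_shift c t : is_term t -> is_term (shift c t).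
Proof.
move=> tt; elim: tt c => {t} [x|t _ IH T0 N0|t1 t2 _ IH1 _ IH2 D1 D2|
  t _ IH T0 N|t1 t2 _ IH1 _ IH2 D1 D2] c /=.
- exact: is_term_var.
- apply: is_term_lam => //; first by rewrite -[0]/(bump c.+1 0) TV_shift.
  by rewrite -[X in no X _]/(bump c.+1 0) no_shift.
- apply: is_term_app => // x; have [->|[y ->]] := bump_cases c x;
  by rewrite ?TV_shift_same ?FV_shift_same ?TV_shift ?FV_shift.
- apply: is_term_bang => // x; have [->|[y ->]] := bump_cases c x.
  + by rewrite TV_shift_same.
  + by rewrite TV_shift.
  + by rewrite FV_shift_same.
  + by rewrite FV_shift no_shift; apply: N.
- apply: is_term_let => // x; have [->|[y ->]] := bump_cases c x;
  rewrite /= ?TV_shift_same ?FV_shift_same ?andbF // -bumpS !TV_shift !FV_shift.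
  + exact: D1.
  + exact: D2.
Qed.

Lemma no_shift0S t x : no x.+1 (shift 0 t) = no x t.
Proof. exact: (no_shift 0). Qed.

(** * Substitution *)

Lemma no_subst k u t x :
  no x (subst k u t) = no (bump k x) t + no k t * no x u.
Proof.
elim: t k u x => [y|t IH|t1 IH1 t2 IH2|t IH|t1 IH1 t2 IH2] k u x //=.
- have [->|[z ->]] := bump_cases k y.
    by rewrite ltnn eqxx eq_sym (negPf (neq_bump k x)) mul1n.
  rewrite (inj_eq (can_inj (bumpK k))) (negPf (neq_bump k z)) addn0.
  rewrite eq_sym (negPf (neq_bump k z)) /bump.
  by case: (leqP k z) => [kz|zk]; [rewrite ltnNge leqW | rewrite zk].
- by rewrite IH bumpS no_shift0S.
- by rewrite IH1 IH2 mulnDl addnACA.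
- by rewrite IH1 IH2 bumpS no_shift0S mulnDl addnACA.
Qed.

Lemma FV_subst k u t x :
  FV (subst k u t) x = FV t (bump k x) || FV t k && FV u x.
Proof. by rewrite !FVE no_subst addn_gt0 muln_gt0. Qed.

(** Inserted under a bang, [u] makes all its free variables temporary; inserted elsewhere, only
    those already temporary in [u]. *)
Lemma TV_subst k u t x : TV (subst k u t) x ->
  [|| TV t (bump k x), TV t k && FV u x | FV t k && TV u x].
Proof.
elim: t k u x => [y|t IH|t1 IH1 t2 IH2|t IH|t1 IH1 t2 IH2] k u x //=.
- by case: ltnP => //=; case: eqVneq.
- move/IH; rewrite bumpS -[x.+1]/(bump 0 x) FV_shift TV_shift; exact.
- by case/orP=> [/IH1|/IH2]; lia.
- by rewrite FV_subst => /orP[]->; rewrite ?orbT.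
- case/orP=> [/IH1|/IH2]; rewrite ?bumpS -?[x.+1]/(bump 0 x) ?FV_shift ?TV_shift; lia.
Qed.

Lemma TV_shift0S t x : TV (shift 0 t) x.+1 = TV t x.
Proof. exact: (TV_shift 0). Qed.

Lemma FV_shift0S t x : FV (shift 0 t) x.+1 = FV t x.
Proof. exact: (FV_shift 0). Qed.

(* Covers beta (first alternative of [no k t <= 1 \/ _]) and both modes of    *)
(* the bang rule: opening the box ([u] copied at depth 0, [TV u] empty) and   *)
(* merging it into another one ([k] temporary in [t]).                        *)
Lemma is_term_subst k u t :
    is_term t -> is_term u ->
    (forall x, ~~ (TV u x && FV t (bump k x))) ->
    (forall x, ~~ (FV u x && TV t (bump k x))) ->
    no k t <= 1 \/ (forall x, ~~ TV u x) ->
    (TV t k -> forall x, [/\ ~~ TV u x, FV u x -> no x u = 1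
                           & ~~ (FV u x && FV t (bump k x))]) ->
  is_term (subst k u t).
Proof.
move=> tt; elim: tt k u => {t} [y|t _ IH T0 N0|t1 t2 _ IH1 _ IH2 D1 D2|
  t _ IH T0 N|t1 t2 _ IH1 _ IH2 D1 D2] k u tu TF FT lin tmp /=;
  (* Boolean form of the disjointness part of [tmp], usable by [lia]. *)
  match type of tmp with is_true (TV ?t k) -> _ =>
    have tmpb x : TV t k ==> ~~ TV u x && ~~ (FV u x && FV t (bump k x))
      by apply/implyP => /tmp/(_ x)[-> _ ->]
  end.
- by case: ifP => _; [apply: is_term_var | case: ifP => _ //; apply: is_term_var].
- apply: is_term_lam; last by rewrite no_subst /= no_shift_same muln0 addn0.
    apply: IH; first exact: is_term_shift.
    + by case=> [|x]; rewrite ?TV_shift_same // TV_shift0S bumpS; apply: TF.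
    + by case=> [|x]; rewrite ?FV_shift_same // FV_shift0S bumpS; apply: FT.
    + case: lin => [|TVu]; first by left.
      by right; case=> [|x]; rewrite ?TV_shift_same ?TV_shift0S.
    + move=> /tmp H; case=> [|x].
        by rewrite TV_shift_same FV_shift_same; split.
      by rewrite TV_shift0S FV_shift0S no_shift0S bumpS; apply: H.
  apply/negP => /TV_subst.
  by rewrite TV_shift_same FV_shift_same !andbF !orbF (negPf T0).
- have dk1 := D1 k; have dk2 := D2 k.
  apply: is_term_app.
  + apply: IH1 => // [x|x||/= Tk x].
    * by have /= := TF x; lia.
    * by have /= := FT x; lia.
    * by case: lin => /= H; [left; lia | right].
    * by have [|/= ? ? ?] := tmp _ x; [rewrite /= Tk | split => //; lia].
  + apply: IH2 => // [x|x||/= Tk x].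
    * by have /= := TF x; lia.
    * by have /= := FT x; lia.
    * by case: lin => /= H; [left; lia | right].
    * by have [|/= ? ? ?] := tmp _ x; [rewrite /= Tk orbT | split => //; lia].
  + move=> x; apply/negP => /andP[/TV_subst]; rewrite FV_subst.
    have /= := TF x; have /= := FT x; have := D1 (bump k x).
    have /= := tmpb x.
    (* If [k] is free in both operands then [u] is copied, which [lin] allows only when [TV u] is
       empty. *)
    have : [|| ~~ FV t1 k, ~~ FV t2 k | ~~ TV u x].
      by case: lin => [/=|-> //]; rewrite !FVE; lia.
    lia.
  + move=> x; apply/negP => /andP[]; rewrite FV_subst => + /TV_subst.
    have /= := TF x; have /= := FT x; have := D2 (bump k x).
    have /= := tmpb x.
    have : [|| ~~ FV t1 k, ~~ FV t2 k | ~~ TV u x].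
      by case: lin => [/=|-> //]; rewrite !FVE; lia.
    lia.
- apply: is_term_bang.
  + apply: IH => //.
    * by move=> x; rewrite (negPf (T0 _)) andbF.
    * by rewrite (negPf (T0 _)).
  + move=> x; apply/negP => /TV_subst; rewrite !(negPf (T0 _)) /=.
    by case/andP => /tmp H TVu; have [] := H x; rewrite TVu.
  + move=> x; rewrite FVE no_subst.
    have := N (bump k x); have := N k; have /= := tmp^~ x; rewrite !FVE.
    (* When [k] is free in the box, [u] and [t] share no other variable, so two single occurrences
       never add up. *)
    case: (posnP (no k t)) => [-> _ _|_ [] // Tu Nu D -> //].
      by rewrite mul0n addn0.
    by case: (posnP (no x u)) Nu D => [->|_ -> //]; lia.
- have /= dk1 := D1 k; have /= dk2 := D2 k.
  apply: is_term_let.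
  + apply: IH1 => // [x|x||/= Tk x].
    * by have /= := TF x; lia.
    * by have /= := FT x; lia.
    * by case: lin => /= H; [left; lia | right].
    * by have [|/= ? ? ?] := tmp _ x; [rewrite /= Tk | split => //; lia].
  + apply: IH2; first exact: is_term_shift.
    * case=> [|x]; rewrite ?TV_shift_same // TV_shift0S bumpS.
      by have /= := TF x; lia.
    * case=> [|x]; rewrite ?FV_shift_same // FV_shift0S bumpS.
      by have /= := FT x; lia.
    * case: lin => /= H; [by left; lia | right].
      by case=> [|x]; rewrite ?TV_shift_same ?TV_shift0S.
    * move=> Tk; case=> [|x]; first by rewrite TV_shift_same FV_shift_same; split.
      rewrite TV_shift0S FV_shift0S no_shift0S bumpS.
      by have [|/= ? ? ?] := tmp _ x; [rewrite /= Tk orbT | split => //; lia].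
  + move=> x; apply/negP => /andP[/TV_subst]; rewrite /= FV_subst FV_shift0S bumpS.
    have /= := TF x; have /= := FT x; have /= := D1 (bump k x).
    have /= := tmpb x.
    have : [|| ~~ FV t1 k, ~~ FV t2 k.+1 | ~~ TV u x].
      by case: lin => [/=|-> //]; rewrite !FVE; lia.
    lia.
  + move=> x; apply/negP => /andP[]; rewrite /= FV_subst => + /TV_subst.
    rewrite FV_shift0S TV_shift0S bumpS.
    have /= := TF x; have /= := FT x; have /= := D2 (bump k x).
    have /= := tmpb x.
    have : [|| ~~ FV t1 k, ~~ FV t2 k.+1 | ~~ TV u x].
      by case: lin => [/=|-> //]; rewrite !FVE; lia.
    lia.
Qed.

(** * Bounding the occurrences of let-bound variables *)

(** Here [n] bounds the number of copies that a (bang) step makes of a box; in a term, a lambda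
    binds at most one occurrence anyway. *)
Fixpoint rank_le (n : nat) (t : pterm) : bool :=
  match t with
  | Var _ => true
  | Lam t1 | Bang t1 => rank_le n t1
  | App t1 t2 => rank_le n t1 && rank_le n t2
  | Let t1 t2 => [&& no 0 t2 <= n, rank_le n t1 & rank_le n t2]
  end.

Lemma rank_le_shift n c t : rank_le n (shift c t) = rank_le n t.
Proof.
elim: t c => [y|t IH|t1 IH1 t2 IH2|t IH|t1 IH1 t2 IH2] c //=.
- by rewrite IH1 IH2.
- by rewrite IH1 IH2 -[X in no X _]/(bump c.+1 0) no_shift.
Qed.

(** Binders of [t] keep their counts because index 0 is fresh in the shifted [u], and each copy of
    [u] brings its own binders unchanged. *)
Lemma rank_le_subst n k u t :
  rank_le n u -> rank_le n t -> rank_le n (subst k u t).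
Proof.
elim: t k u => [y|t IH|t1 IH1 t2 IH2|t IH|t1 IH1 t2 IH2] k u ru //=.
- by case: ifP => // _; case: ifP.
- by apply: IH; rewrite rank_le_shift.
- by case/andP => r1 r2; rewrite IH1 ?IH2.
- exact: IH.
- case/and3P => n0 r1 r2; rewrite IH1 ?IH2 ?rank_le_shift //.
  by rewrite no_subst no_shift_same muln0 addn0 n0.
Qed.

Lemma term_size_gt0 t : 0 < term_size t.
Proof. by elim: t => //= *; lia. Qed.

Lemma no_le_size x t : no x t <= term_size t.
Proof.
elim: t x => [y|t IH|t1 IH1 t2 IH2|t IH|t1 IH1 t2 IH2] x /=.
- by case: eqP.
- by have := IH x.+1; lia.
- by have := IH1 x; have := IH2 x; lia.
- by have := IH x; lia.
- by have := IH1 x; have := IH2 x.+1; lia.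
Qed.

(** Supplies the initial bound: the size of the starting term can serve as [n]. *)
Lemma rank_le_size n t : term_size t <= n -> rank_le n t.
Proof.
elim: t => //= [t IH|t1 IH1 t2 IH2|t IH|t1 IH1 t2 IH2] le_n.
- by apply: IH; lia.
- by rewrite IH1 ?IH2 //; lia.
- by apply: IH; lia.
- by rewrite IH1 ?IH2 ?andbT; have := no_le_size 0 t2; lia.
Qed.

(** * Invariants of reduction *)

Lemma FV_step t t' x : step t t' -> FV t' x -> FV t x.
Proof.
move=> st; elim: st x => {t t'} [t u|u t|t1 t2 t3|t1 t2 t3|t t' _ IH|t t' u _ IH|
  t u u' _ IH|t t' _ IH|t t' u _ IH|t u u' _ IH] x /=.
- by rewrite FV_subst -[bump 0 x]/x.+1; lia.
- by rewrite FV_subst -[bump 0 x]/x.+1; lia.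
- by rewrite (FV_shift 1 t3 x.+1); lia.
- by rewrite FV_shift0S; lia.
- exact: IH.
- by case/orP => [/IH|] ->; rewrite ?orbT.
- by case/orP => [|/IH] ->; rewrite ?orbT.
- exact: IH.
- by case/orP => [/IH|] ->; rewrite ?orbT.
- by case/orP => [|/IH] ->; rewrite ?orbT.
Qed.

(** In (beta) the bound variable is not temporary, so no further variable of [u] becomes so; in
    (bang) the free variables of the opened box were temporary already. *)
Lemma TV_step t t' x : is_term t -> step t t' -> TV t' x -> TV t x.
Proof.
move=> + st; elim: st x => {t t'} [t u|u t|t1 t2 t3|t1 t2 t3|t t' st IH|t t' u _ IH|
  t u u' _ IH|t t' st IH|t t' u _ IH|t u u' _ IH] x.
- case/is_term_app_inv => /is_term_lam_inv[_ T0 _] _ _ _ /TV_subst; rewrite -[bump 0 x]/x.+1 /=.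
  by rewrite (negPf T0) /=; lia.
- case/is_term_let_inv => /is_term_bang_inv[_ T0 _] _ _ _ /TV_subst; rewrite -[bump 0 x]/x.+1 /=.
  by rewrite (negPf (T0 x)) /=; lia.
- by move=> _ /=; rewrite (TV_shift 1 t3 x.+1); lia.
- by move=> _ /=; rewrite TV_shift0S; lia.
- by case/is_term_lam_inv => ? _ _ /=; apply: IH.
- by case/is_term_app_inv => ? _ _ _ /= /orP[/IH|] ->; rewrite ?orbT.
- by case/is_term_app_inv => _ ? _ _ /= /orP[|/IH] ->; rewrite ?orbT.
- by case/is_term_bang_inv => _ _ _ /=; apply: FV_step.
- by case/is_term_let_inv => ? _ _ _ /= /orP[/IH|] ->; rewrite ?orbT.
- by case/is_term_let_inv => _ ? _ _ /= /orP[|/IH] ->; rewrite ?orbT.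
Qed.

(* Only the free variables of a box can be duplicated, and only once: after   *)
(* the box is opened they are at depth 0, where nothing is ever copied.       *)
Lemma no_step n t t' x : 0 < n -> is_term t -> rank_le n t -> step t t' ->
  no x t' <= if TV t x then n else no x t.
Proof.
move=> n0 + + st; elim: st x => {t t'} [t u|u t|t1 t2 t3|t1 t2 t3|t t' st IH|
  t t' u _ IH|t u u' _ IH|t t' st IH|t t' u _ IH|t u u' _ IH] x tt rt.
- have := TV_no _ x tt.
  have [/is_term_lam_inv[_ _ N0] _ _ _] := is_term_app_inv _ _ tt.
  rewrite no_subst -[bump 0 x]/x.+1 /=.
  have : no 0 t * no x u <= 1 * no x u by rewrite leq_mul2r N0 orbT.
  by case: ifP => // _; [move=> + /(_ isT) | ]; lia.
- have [/is_term_bang_inv[_ _ N] _ D _] := is_term_let_inv _ _ tt.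
  have := TV_no _ x tt; have := N x; have := D x.
  case/andP: rt => /= rn _.
  rewrite no_subst -[bump 0 x]/x.+1 /= !FVE.
  (* A free [x] of the box occurs once in [u] and not in [t], so its new count is [no 0 t], at most
     [n]. *)
  case: (posnP (no x u)) => [->|_ /= + -> // _]; first by case: ifP => /=; lia.
  by lia.
- have := TV_no _ x tt; case: ifP => [_ /(_ isT)|_ _] /=;
  by rewrite (no_shift 1 t3 x.+1); lia.
- have := TV_no _ x tt; case: ifP => [_ /(_ isT)|_ _] /=;
  by rewrite no_shift0S; lia.
- by case/is_term_lam_inv: tt => ? _ _; apply: IH.
- case/is_term_app_inv: tt => tt1 tt2 D1 D2; case/andP: rt => r1 r2.
  have := IH x tt1 r1; have := D1 x; have := D2 x; have := TV_no _ x tt2.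
  by rewrite /= !FVE; case: (TV t x); case: (TV u x) => //=; lia.
- case/is_term_app_inv: tt => tt1 tt2 D1 D2; case/andP: rt => r1 r2.
  have := IH x tt2 r2; have := D1 x; have := D2 x; have := TV_no _ x tt1.
  by rewrite /= !FVE; case: (TV t x); case: (TV u x) => //=; lia.
- case/is_term_bang_inv: tt => tt T0 N.
  (* The body of a box has no temporary variable, so a count of 1 cannot grow inside it. *)
  have := IH x tt rt; have := N x; rewrite (negPf (T0 x)) /= FVE.
  by case: posnP => //= _ -> //; lia.
- case/is_term_let_inv: tt => tt1 tt2 D1 D2; case/and3P: rt => _ r1 r2.
  have := IH x tt1 r1; have := D1 x; have := D2 x; have := TV_no _ x.+1 tt2.
  by rewrite /= !FVE; case: (TV t x); case: (TV u x.+1) => //=; lia.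
- case/is_term_let_inv: tt => tt1 tt2 D1 D2; case/and3P: rt => _ r1 r2.
  have := IH x.+1 tt2 r2; have := D1 x; have := D2 x; have := TV_no _ x tt1.
  by rewrite /= !FVE; case: (TV t x); case: (TV u x.+1) => //=; lia.
Qed.

Lemma rank_le_step n t t' :
  0 < n -> is_term t -> rank_le n t -> step t t' -> rank_le n t'.
Proof.
move=> n0 + + st; elim: st => {t t'} [t u|u t|t1 t2 t3|t1 t2 t3|t t' st IH|
  t t' u _ IH|t u u' _ IH|t t' st IH|t t' u _ IH|t u u' st IH] tt /=.
- by case/andP => rt ru; apply: rank_le_subst.
- by case/and3P => _ ru rt; apply: rank_le_subst.
- rewrite rank_le_shift no_shift_same -[X in no X (shift 1 t3)]/(bump 1 0).
  by rewrite no_shift; lia.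
- by rewrite rank_le_shift no_shift_same; lia.
- by case/is_term_lam_inv: tt => ? _ _; apply: IH.
- by case/is_term_app_inv: tt => ? _ _ _ /andP[/IH-> // ->].
- by case/is_term_app_inv: tt => _ ? _ _ /andP[-> /IH->].
- by case/is_term_bang_inv: tt => ? _ _; apply: IH.
- by case/is_term_let_inv: tt => ? _ _ _ /and3P[-> /IH-> // ->].
(* If index 0 is temporary, it has at most [n] occurrences after the step; otherwise its count does
   not grow. *)
- case/is_term_let_inv: tt => _ tt2 _ _ /and3P[le_n -> r2].
  rewrite IH // !andbT; have := no_step n u u' 0 n0 tt2 r2 st.
  by case: ifP => // _; lia.
Qed.

Lemma is_term_step t t' : is_term t -> step t t' -> is_term t'.
Proof.
move=> + st; elim: st => {t t'} [t u|u t|t1 t2 t3|t1 t2 t3|t t' st IH|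
  t t' u st IH|t u u' st IH|t t' st IH|t t' u st IH|t u u' st IH].
- case/is_term_app_inv => /is_term_lam_inv[tt T0 N0] tu D1 D2.
  apply: is_term_subst => //; last by rewrite (negPf T0).
  + by move=> x; rewrite andbC; apply: D2.
  + by move=> x; rewrite andbC; apply: D1.
  + by left.
- case/is_term_let_inv => /is_term_bang_inv[tu T0 N] tt D1 D2.
  apply: is_term_subst => //.
  + by move=> x; rewrite (negPf (T0 x)).
  + by right.
  + by move=> _ x; split; [apply: T0 | apply: N | apply: D1].
- case/is_term_let_inv => /is_term_let_inv[tt1 tt2 D1 D2] tt3 D3 D4.
  apply: is_term_let => //.
  + apply: is_term_let; rewrite //; first exact: is_term_shift.
    (* Index 0 is the variable bound by the outer [Let], absent from [t3]; for the other indices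
       [D3] applies. *)
    * case=> [|x] /=; rewrite -?[1]/(bump 1 0).
        by rewrite FV_shift_same andbF.
      by rewrite (FV_shift 1 t3 x.+1); have /= := D3 x; lia.
    * case=> [|x] /=; first by rewrite TV_shift_same andbF.
      by rewrite (TV_shift 1 t3 x.+1); have /= := D4 x; lia.
  + move=> x /=; rewrite (FV_shift 1 t3 x.+1).
    by have /= := D1 x; have /= := D3 x; lia.
  + move=> x /=; rewrite (TV_shift 1 t3 x.+1).
    by have /= := D2 x; have /= := D4 x; lia.
- case/is_term_app_inv => /is_term_let_inv[tt1 tt2 D1 D2] tt3 D3 D4.
  apply: is_term_let => //.
  + apply: is_term_app; rewrite //; first exact: is_term_shift.
    * case=> [|x]; first by rewrite FV_shift_same andbF.
      by rewrite FV_shift0S; have /= := D3 x; lia.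
    * case=> [|x]; first by rewrite TV_shift_same andbF.
      by rewrite TV_shift0S; have /= := D4 x; lia.
  + move=> x /=; rewrite FV_shift0S.
    by have /= := D1 x; have /= := D3 x; lia.
  + move=> x /=; rewrite TV_shift0S.
    by have /= := D2 x; have /= := D4 x; lia.
- case/is_term_lam_inv => tt T0 N0; apply: is_term_lam; first exact: IH.
    by apply: contra T0; apply: TV_step.
  (* Index 0 is not temporary, so its count does not grow whichever admissible [n] is chosen; the
     size of [t] is one. *)
  have := no_step (term_size t) t t' 0 (term_size_gt0 t) tt
    (rank_le_size _ _ (leqnn _)) st.
  by rewrite (negPf T0); lia.
- case/is_term_app_inv => tt1 tt2 D1 D2; apply: is_term_app => //.
  + exact: IH.
  + move=> x; apply: contra (D1 x) => /andP[/(TV_step _ _ _ tt1 st)-> ->] //.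
  + move=> x; apply: contra (D2 x) => /andP[/(FV_step _ _ _ st)-> ->] //.
- case/is_term_app_inv => tt1 tt2 D1 D2; apply: is_term_app => //.
  + exact: IH.
  + move=> x; apply: contra (D1 x) => /andP[-> /(FV_step _ _ _ st)->] //.
  + move=> x; apply: contra (D2 x) => /andP[-> /(TV_step _ _ _ tt2 st)->] //.
- case/is_term_bang_inv => tt T0 N; apply: is_term_bang; first exact: IH.
    by move=> x; apply: contra (T0 x); apply: TV_step.
  move=> x Fx; have := no_step (term_size t) t t' x (term_size_gt0 t) tt
    (rank_le_size _ _ (leqnn _)) st.
  rewrite (negPf (T0 x)) (N x (FV_step _ _ _ st Fx)).
  by move: Fx; rewrite FVE; lia.
- case/is_term_let_inv => tt1 tt2 D1 D2; apply: is_term_let => //.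
  + exact: IH.
  + move=> x; apply: contra (D1 x) => /andP[/(TV_step _ _ _ tt1 st)-> ->] //.
  + move=> x; apply: contra (D2 x) => /andP[/(FV_step _ _ _ st)-> ->] //.
- case/is_term_let_inv => tt1 tt2 D1 D2; apply: is_term_let => //.
  + exact: IH.
  + move=> x; apply: contra (D1 x) => /andP[-> /= /(FV_step _ _ _ st)->] //.
  + move=> x; apply: contra (D2 x) => /andP[-> /= /(TV_step _ _ _ tt2 st)->] //.
Qed.

(** * The two measures *)

Fixpoint weight (n : nat) (t : pterm) : nat :=
  match t with
  | Var _ => 1
  | Lam t1 => weight n t1 + 1
  | App t1 t2 => weight n t1 + weight n t2
  | Bang t1 => n * weight n t1 + 1
  | Let t1 t2 => weight n t1 + weight n t2 + 1
  end.

Fixpoint left_weight (n : nat) (t : pterm) : nat :=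
  match t with
  | Var _ => 0
  | Lam t1 | Bang t1 => left_weight n t1
  | App t1 t2 | Let t1 t2 => left_weight n t1 + left_weight n t2 + weight n t1
  end.

Lemma weight_gt0 n t : 0 < weight n t.
Proof. by elim: t => //= *; lia. Qed.

Lemma weight_shift n c t : weight n (shift c t) = weight n t.
Proof.
elim: t c => [y|t IH|t1 IH1 t2 IH2|t IH|t1 IH1 t2 IH2] c //=;
  by rewrite ?IH ?IH1 ?IH2.
Qed.

Lemma left_weight_shift n c t : left_weight n (shift c t) = left_weight n t.
Proof.
elim: t c => [y|t IH|t1 IH1 t2 IH2|t IH|t1 IH1 t2 IH2] c //=;
  by rewrite ?weight_shift ?IH ?IH1 ?IH2.
Qed.

(** The cross term in the square of a sum absorbs the extra [weight n t1], since weights are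
    positive. *)
Lemma left_weight_le n t : 0 < n -> left_weight n t <= weight n t ^ 2.
Proof.
move=> n0; elim: t => [y|t IH|t1 IH1 t2 IH2|t IH|t1 IH1 t2 IH2] //=.
- by nia.
- by have := weight_gt0 n t2; nia.
- by apply: leq_trans IH _; rewrite leq_exp2r //; nia.
- by nia.
Qed.

(** An occurrence outside bangs adds at most [weight n u]; a temporary [k] has one occurrence, under
    exactly one bang, where it counts [n] times. *)
Lemma weight_subst n k u t : 0 < n -> is_term t ->
  weight n (subst k u t) <=
  weight n t + (if TV t k then n else no k t) * weight n u.
Proof.
move=> n0 tt; elim: tt k u => {t} [y|t _ IH T0 N0|t1 t2 tt1 IH1 tt2 IH2 D1 D2|
  t _ IH T0 N|t1 t2 tt1 IH1 tt2 IH2 D1 D2] k u /=.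
- by case: ltnP => //= _; rewrite [k == y]eq_sym; case: eqVneq => //= _; lia.
- by have := IH k.+1 (shift 0 u); rewrite weight_shift; lia.
- have := IH1 k u; have := IH2 k u; have := D1 k; have := D2 k.
  rewrite /= !FVE; have := TV_no _ k tt1; have := TV_no _ k tt2.
  by case: (TV t1 k); case: (TV t2 k) => //= *; nia.
- have := IH k u; have := N k; rewrite (negPf (T0 k)) FVE.
  by case: posnP => [->|_ -> //] *; nia.
- have := IH1 k u; have := IH2 k.+1 (shift 0 u); have := D1 k; have := D2 k.
  rewrite /= !FVE weight_shift; have := TV_no _ k tt1; have := TV_no _ k.+1 tt2.
  by case: (TV t1 k); case: (TV t2 k.+1) => //= *; nia.
Qed.

Lemma weight_step n t t' : 0 < n -> is_term t -> rank_le n t -> step t t' ->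
  weight n t' < weight n t \/
  weight n t' = weight n t /\ left_weight n t' < left_weight n t.
Proof.
move=> n0 + + st; elim: st => {t t'} [t u|u t|t1 t2 t3|t1 t2 t3|t t' st IH|
  t t' u _ IH|t u u' _ IH|t t' st IH|t t' u _ IH|t u u' st IH] tt /= rt.
- case/is_term_app_inv: tt => /is_term_lam_inv[tt T0 N0] _ _ _; left.
  have := weight_subst n 0 u t n0 tt; rewrite (negPf T0).
  by have := weight_gt0 n u; nia.
(* The box reserves [n] copies of [u], which covers either alternative of [weight_subst]; the
   constants lost make the decrease strict. *)
- case/is_term_let_inv: tt => _ tt _ _; left.
  have := weight_subst n 0 u t n0 tt; case/and3P: rt => rn _ _.
  by case: ifP => _ *; nia.
(* In both commutations the left operand [Let t1 t2] gives way to [t2], so the left weight drops by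
   [weight n t1 + 1]. *)
- by right; rewrite weight_shift left_weight_shift; lia.
- by right; rewrite weight_shift left_weight_shift; lia.
- by case/is_term_lam_inv: tt => tt _ _; case: (IH tt rt); lia.
- case/is_term_app_inv: tt => tt _ _ _; case/andP: rt => rt _.
  by case: (IH tt rt); lia.
- case/is_term_app_inv: tt => _ tt _ _; case/andP: rt => _ rt.
  by case: (IH tt rt); lia.
- case/is_term_bang_inv: tt => tt _ _; case: (IH tt rt) => [lt|[-> ?]].
    by left; nia.
  by right.
- case/is_term_let_inv: tt => tt _ _ _; case/and3P: rt => _ rt _.
  by case: (IH tt rt); lia.
- case/is_term_let_inv: tt => _ tt _ _; case/and3P: rt => _ _ rt.
  by case: (IH tt rt); lia.
Qed.

(** * Length of a reduction *)

(** Lexicographic descent: a drop of the weight frees [B + 1], which pays for the step and for a new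
    left weight of at most [B]. One [B] serves throughout because the weight never increases. *)
Lemma reduction_length_le n B m (s : nat -> pterm) :
    0 < n -> is_term (s 0) -> rank_le n (s 0) ->
    weight n (s 0) ^ 2 <= B -> (forall i, i < m -> step (s i) (s i.+1)) ->
  m <= weight n (s 0) * B.+1 + left_weight n (s 0).
Proof.
move=> n0; elim: m s => // m IH s ts rs leB st.
have st0 := st 0 isT.
have ts1 := is_term_step _ _ ts st0.
have rs1 := rank_le_step _ _ _ n0 ts rs st0.
have ws := weight_step _ _ _ n0 ts rs st0.
have leB1 : weight n (s 1) ^ 2 <= B by case: ws; nia.
have := IH (fun i => s i.+1) ts1 rs1 leB1 (fun i => st i.+1).
have := left_weight_le n (s 1) n0.
by case: ws => [|[-> ?]]; nia.
Qed.


(** * Depth of subterms and its effect on the weight *)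

Lemma occs_nil t : [::] \in occs t.
Proof. by case: t => *; rewrite inE. Qed.

(** Prefixing by [i] embeds the occurrences of [t1] into those of [t]; [c] accounts for a bang at
    the root of [t], hence is 1 for [Bang] and 0 otherwise. *)
Lemma depth_geD c i t t1 :
    (forall p, p \in occs t1 ->
      i :: p \in occs t /\ occ_depth t1 p + c <= occ_depth t (i :: p)) ->
  depth t1 + c <= depth t.
Proof.
move=> H.
have le_depth p : p \in occs t1 -> occ_depth t1 p + c <= depth t.
  case/H => pt /leq_trans; apply.
  by apply: (@leq_bigmax_seq _ (occs t) xpredT (occ_depth t)).
(* The root occurrence of [t1] ensures that the truncated subtraction below is exact. *)
have le_c : c <= depth t by have := le_depth _ (occs_nil t1); lia.
rewrite addnC -leq_subRL //; apply/bigmax_leqP_seq => p pt _.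
by rewrite leq_subRL // addnC; apply: le_depth.
Qed.

Lemma mem_map_cons (i : nat) p (s : seq (seq nat)) :
  p \in s -> i :: p \in [seq i :: q | q <- s].
Proof. by rewrite mem_map // => ? ? []. Qed.

Lemma depth_lam t : depth t <= depth (Lam t).
Proof.
rewrite -[X in X <= _]addn0; apply: (@depth_geD 0 0) => p pt.
rewrite inE mem_map_cons //; split=> //.
by rewrite addn0 /occ_depth /= count_map /=.
Qed.

Lemma depth_bang t : depth t < depth (Bang t).
Proof.
rewrite -addn1; apply: (@depth_geD 1 0) => p pt.
rewrite inE mem_map_cons //; split=> //.
by rewrite /occ_depth /= count_map addnC.
Qed.

Lemma depth_app t1 t2 :
  depth t1 <= depth (App t1 t2) /\ depth t2 <= depth (App t1 t2).
Proof.
split; rewrite -[X in X <= _]addn0;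
  [apply: (@depth_geD 0 0) | apply: (@depth_geD 0 1)] => p pt;
  rewrite inE mem_cat mem_map_cons // ?orbT; split=> //;
  rewrite addn0 /occ_depth /= count_cat !count_map /=.
- exact: leq_addr.
- exact: leq_addl.
Qed.

Lemma depth_let t1 t2 :
  depth t1 <= depth (Let t1 t2) /\ depth t2 <= depth (Let t1 t2).
Proof.
split; rewrite -[X in X <= _]addn0;
  [apply: (@depth_geD 0 0) | apply: (@depth_geD 0 1)] => p pt;
  rewrite inE mem_cat mem_map_cons // ?orbT; split=> //;
  rewrite addn0 /occ_depth /= count_cat !count_map /=.
- exact: leq_addr.
- exact: leq_addl.
Qed.

(** Each level of boxes costs one factor [n]. *)
Lemma weight_le n d t : 0 < n -> depth t <= d -> weight n t <= term_size t * n ^ d.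
Proof.
move=> n0; have n_gt0 e : 0 < n ^ e by rewrite expn_gt0 n0.
elim: t d => [y|t IH|t1 IH1 t2 IH2|t IH|t1 IH1 t2 IH2] d le_d /=.
- by have := n_gt0 d; lia.
- have := IH _ (leq_trans (depth_lam t) le_d); have := n_gt0 d; nia.
- have [d1 d2] := depth_app t1 t2.
  by have := IH1 _ (leq_trans d1 le_d); have := IH2 _ (leq_trans d2 le_d); nia.
(* A box has positive depth, which rules out exponent 0; its body is bounded with exponent one less,
   and the spare factor [n] pays for the copies. *)
- case: d le_d => [|d] le_d; have := leq_trans (depth_bang t) le_d => //.
  rewrite ltnS => /IH; have := n_gt0 d; rewrite expnS mulnDl mul1n => ? le_w.
  by apply: leq_add; [rewrite mulnCA leq_mul2l le_w orbT | nia].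
- have [d1 d2] := depth_let t1 t2; have := n_gt0 d.
  by have := IH1 _ (leq_trans d1 le_d); have := IH2 _ (leq_trans d2 le_d); nia.
Qed.

(** * The polynomial bound *)

Lemma step_size_gt1 t t' : step t t' -> 1 < term_size t.
Proof.
case: t => [x|t|t1 t2|t|t1 t2] st /=; first by inversion st.
- by have := term_size_gt0 t; lia.
- by have := term_size_gt0 t1; have := term_size_gt0 t2; lia.
- by have := term_size_gt0 t; lia.
- by have := term_size_gt0 t1; lia.
Qed.

Theorem mainTheorem1 :
  exists P : nat -> {poly nat},
    (exists a b : nat, forall d : nat, size (P d) = (a * d + b).+1) /\
    (forall (d : nat) (t : pterm), is_term t -> depth t = d ->
     forall (m : nat) (s : nat -> pterm),
       s 0 = t -> (forall i : nat, i < m -> step (s i) (s i.+1)) ->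
       m <= ((P d).[term_size t])%R).
Proof.
(* The cube of the weight is at most [N ^ (3 * (d + 1))], and two further factors [N] absorb a
   constant 3. The [size] of a polynomial is its degree plus one. *)
exists (fun d => 'X^(3 * d + 5))%R; split.
  by exists 3, 5 => d; rewrite size_polyXn.
move=> d t tt dt m s s0 st; rewrite hornerXn.
have -> : (term_size t ^+ (3 * d + 5))%R = term_size t ^ (3 * d + 5).
  by elim: (3 * d + 5) => // e IH; rewrite GRing.exprS IH expnS.
(* Only a nonempty reduction needs an argument, and its first step forces size at least 2, whence
   [3 <= N ^ 2]. *)
case: m st => // m st.
set N := term_size t.
have N2 : 1 < N.
  by have := st 0 isT; rewrite s0; apply: step_size_gt1.
have N0 : 0 < N by lia.
pose w := weight N t.
have w0 : 0 < w := weight_gt0 N t.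
have le_w : w <= N ^ d.+1.
  by rewrite expnS; apply: weight_le => //; rewrite dt.
have := @reduction_length_le N (w ^ 2) m.+1 s N0.
rewrite s0 => /(_ tt (rank_le_size _ _ (leqnn _)) (leqnn _) st).
have := left_weight_le N t N0; rewrite -/w => le_l le_m.
(* The length is at most [w * (w ^ 2 + 1) + w ^ 2], three monomials each bounded by [w ^ 3]. *)
apply: (@leq_trans (3 * w ^ 3)); first by nia.
have -> : 3 * d + 5 = 2 + d.+1 * 3 by lia.
rewrite expnD expnM; apply: leq_mul; first by nia.
by rewrite leq_exp2r.
Qed.
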